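(* For every integer $k>1$, there are infinitely many odd positive integers $h$ with exactly $k$ distinct prime divisors (i.e. $\omega(h)=k$) such that there does not exist a circulant Hadamard matrix of order $n=4h^2$.
   Context: A Hadamard matrix of order $n$ is an $n\times n$ matrix $H$ with all entries in $\{-1,1\}$ such that $HH^{T}=nI_n$. A matrix $H=\mathrm{circ}(h_1,\ldots,h_n)$ is circulant if its $i$-th row is $[h_{1-i+1},\ldots,h_{n-i+1}]$, subscripts taken modulo $n$ (so each row is the cyclic shift of the previous one by one position to the right). $\omega(h)$ denotes the number of distinct prime divisors of $h$. *)

(* Defs.v *)
From mathcomp Require Import all_boot all_order all_algebra.
From mathcomp Require Import classical_sets cardinality.
Set Implicit Arguments.
Unset Strict Implicit.
Unset Printing Implicit Defensive.
Import GRing.Theory.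
Local Open Scope ring_scope.

Definition hadamard (n : nat) (H : 'M[int]_n) : Prop :=
  (forall i j, H i j = -1 \/ H i j = 1) /\ H *m H^T = (n%:R)%:M.

(* The index (j - i) mod n; n is added because subtraction on nat is
   truncated. *)
Definition ord_diff (n : nat) (j i : 'I_n) : 'I_n :=
  Ordinal (ltn_pmod (j + n - i) (leq_ltn_trans (leq0n i) (ltn_ord i))).

(* With indices running over 0, ..., n-1 instead of 1, ..., n, the entry
   h_(j-i+1) becomes h_(j-i). *)
Definition circ (n : nat) (h : 'rV[int]_n) : 'M[int]_n :=
  \matrix_(i, j) h 0 (ord_diff j i).

Definition circulant (n : nat) (H : 'M[int]_n) : Prop :=
  exists h : 'rV[int]_n, H = circ h.

Definition omega (h : nat) : nat := size (primes h).

(* Main.v *)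
(* Write n = 4h^2 with h = p^a m and p^a > 8 m^2, and put q = p^(2a), s = q/p,
   Phi = Phi_q = Phi_p(X^s).  The first row of a circulant Hadamard matrix of
   order n gives a polynomial R with coefficients +-1 such that
   R(X) R(X^-1) = n mod X^q - 1.  As p is totally ramified in Z[X]/Phi and the
   prime above it is fixed by conjugation, p^a divides R modulo Phi, so p^a
   divides R (X^s - 1) modulo X^q - 1.  The coefficients of the latter,
   reduced modulo X^q - 1, are at most 2n/q = 8 m^2 < p^a in absolute value,
   hence vanish; so Phi divides R and therefore n, which is absurd.  With p = 3
   and m a product of k - 1 primes other than 3, a ranges over all large
   integers. *)
Require Import Defs.
From mathcomp Require Import all_boot all_order all_algebra.
From mathcomp Require Import classical_sets cardinality.
From mathcomp Require Import ring zify.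
Local Open Scope classical_set_scope.

Section NoCirculantHadamard.
Set Implicit Arguments.
Unset Strict Implicit.
Unset Printing Implicit Defensive.
Import GRing.Theory Num.Theory Order.TTheory.
Import Pdiv.CommonRing Pdiv.RingMonic.
Local Open Scope ring_scope.

(** * Cyclotomic polynomials of prime power index *)

(* When [s] is a power of the prime [p], this is the cyclotomic polynomial of
   index [p s]. *)
Definition cyclo (p s : nat) : {poly int} := \sum_(i < p) ('X^s) ^+ i.

(** Divisibility in the quotient ring Z[X]/[Phi], kept in [{poly int}] by means of explicit
    cofactors. *)
Definition dvd_mod (Phi d F : {poly int}) : Prop :=
  exists U V, F = U * d + V * Phi.

Lemma cyclo_mulXn1 p s : cyclo p s * ('X^s - 1) = 'X^(p * s) - 1.
Proof. by rewrite mulnC exprM [RHS]subrX1 mulrC. Qed.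

Lemma horner_cyclo1 p s : (cyclo p s).[1] = p%:R.
Proof.
rewrite /cyclo horner_sum (eq_bigr (fun=> 1)) ?sumr_const ?card_ord //.
by move=> i _; rewrite horner_exp hornerXn !expr1n.
Qed.

Lemma size_Xn_sub1 (R : nzRingType) n : (0 < n)%N ->
  size ('X^n - 1 : {poly R}) = n.+1.
Proof. exact: size_XnsubC. Qed.

Lemma monic_Xn_sub1 (R : nzRingType) n : (0 < n)%N ->
  ('X^n - 1 : {poly R}) \is monic.
Proof. exact: monicXnsubC. Qed.

(** After multiplication by ['X^s - 1] the left side has degree [s], while the right side has degree
    at least [p * s]. *)
Lemma cyclo_ndvd_nat p s n (V : {poly int}) :
  (1 < p)%N -> (0 < s)%N -> (0 < n)%N -> n%:R = V * cyclo p s -> False.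
Proof.
move=> p1 s0 n0 e.
have ps0 : (0 < p * s)%N by rewrite muln_gt0 s0 ltnW.
have e2 : n%:R%:P * ('X^s - 1) = V * ('X^(p * s) - 1) :> {poly int}.
  by rewrite rmorph_nat e -mulrA cyclo_mulXn1.
have n0' : n%:R != 0 :> int by rewrite pnatr_eq0 -lt0n.
have V0 : V != 0.
  apply/eqP => V0; move/eqP: e2; rewrite V0 mul0r mulf_eq0 polyC_eq0 (negPf n0') /=.
  by rewrite -size_poly_eq0 size_Xn_sub1.
have := congr1 (fun P : {poly int} => size P) e2.
rewrite size_Cmul // size_Mmonic ?monic_Xn_sub1 // !size_Xn_sub1 // addnS /=.
have : (0 < size V)%N by rewrite lt0n size_poly_eq0.
have : (s < p * s)%N by rewrite -{1}[s]mul1n ltn_pmul2r.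
by move=> h1 h2 h3; have := leq_add h2 h1; rewrite -h3 add1n ltnn.
Qed.

(** * Total ramification of [p] modulo [Phi] *)

Lemma modp_poly0 p (F : {poly int}) : prime p ->
  map_poly (intr : int -> 'F_p) F = 0 -> exists G, F = p%:R * G.
Proof.
move=> pp e; exists (\poly_(i < size F) (F`_i %/ p)%Z).
apply/polyP => i; rewrite -(rmorph_nat polyC) coefCM coef_poly.
case: ltnP => [_|h]; last by rewrite nth_default ?mulr0.
have := congr1 (fun P : {poly _} => P`_i) e; rewrite coef_map coef0 => /eqP.
rewrite -(dvdz_pcharf (pchar_Fp pp)) => /divzK {1}<-.
by rewrite mulrC natz.
Qed.

(* By Frobenius, modulo [p] both sides become [X^(ps) - 1] once multiplied by
   [(X - 1)^s], where [s = p^b]. *)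
Lemma cyclo_modp p b : prime p ->
  exists G, ('X - 1) ^+ (p * p ^ b - p ^ b) = cyclo p (p ^ b) + p%:R * G.
Proof.
move=> pp; set s := (p ^ b)%N.
have p0 := prime_gt0 pp.
have pc : p \in [pchar {poly 'F_p}].
  by rewrite (rmorph_pchar (@polyC _)) // pchar_Fp.
have frob m : ('X - 1 : {poly 'F_p}) ^+ (p ^ m) = 'X^(p ^ m) - 1.
  have pn : ([pchar {poly 'F_p}]).-nat (p ^ m)%N.
    by rewrite pnatX pnatE // pc.
  apply/eqP; rewrite -subr_eq opprK; apply/eqP.
  by rewrite -{2}[1](expr1n _ (p ^ m)) -exprDn_pchar // subrK.
have X1 : ('X - 1 : {poly 'F_p}) != 0 by rewrite polyXsubC_eq0.
have lesps : (s <= p * s)%N by rewrite leq_pmull.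
have [G HG] : exists G, ('X - 1) ^+ (p * s - s) - cyclo p s = p%:R * G.
  apply: modp_poly0 => //; rewrite rmorphB rmorphXn rmorphB /= map_polyX rmorph1.
  apply/eqP; rewrite subr_eq0; apply/eqP.
  apply: (mulIf (x := ('X - 1) ^+ s)); first by rewrite expf_neq0.
  rewrite -exprD subnK // /s -[(p * _)%N]expnS !frob expnS -/s.
  have -> : 'X^s - 1 = map_poly (intr : int -> 'F_p) ('X^s - 1).
    by rewrite rmorphB rmorphXn /= map_polyX rmorph1.
  rewrite -rmorphM cyclo_mulXn1.
  by rewrite rmorphB rmorphXn /= map_polyX rmorph1.
by exists G; rewrite -HG [RHS]addrC subrK.
Qed.

Lemma X_sub1_root (F : {poly int}) : exists K, F = F.[1]%:P + K * ('X - 1).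
Proof.
have /factor_theorem [K HK] : root (F - F.[1]%:P) 1.
  by rewrite /root !hornerE subrr.
by exists K; rewrite -HK addrC subrK.
Qed.

(** Modulo [Phi], [(X - 1)^phi = p * G] with [G.[1] = -1], so [G = t - 1] where [t] is a multiple of
    [X - 1]. The geometric sum inverts [1 - t] up to [t^phi], itself a multiple of [(X - 1)^phi]. *)
Lemma cyclo_dvd_p p b : prime p ->
  dvd_mod (cyclo p (p ^ b)) (('X - 1) ^+ (p * p ^ b - p ^ b)) p%:R.
Proof.
move=> pp; have [G HG] := cyclo_modp b pp.
set phi := (p * p ^ b - p ^ b)%N in HG *; set Phi := cyclo _ _ in HG *.
have phi0 : (0 < phi)%N.
  by rewrite subn_gt0 ltn_Pmull ?prime_gt1 // expn_gt0 prime_gt0.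
have G1 : G.[1] = -1.
  have := congr1 (horner^~ 1) HG; rewrite !hornerE subrr expr0n gtn_eqF // horner_cyclo1.
  rewrite -(rmorph_nat polyC) hornerC => /esym e.
  have p0 : p%:R != 0 :> int by rewrite pnatr_eq0 -lt0n prime_gt0.
  by apply: (mulfI p0); apply/eqP; rewrite mulrN1 -addr_eq0 addrC; apply/eqP.
have [K HK] := X_sub1_root G; rewrite G1 in HK.
set t := K * ('X - 1) in HK.
have HG' : p%:R * (1 - t) = Phi - ('X - 1) ^+ phi.
  by rewrite HG HK rmorphN rmorph1; ring.
exists (p%:R * K ^+ phi - \sum_(i < phi) t ^+ i), (\sum_(i < phi) t ^+ i).
have := subrX1 t phi; rewrite exprMn; set S := \sum_(i < _) _ => HS.
have e : p%:R = p%:R * (1 - t) * S + p%:R * (K ^+ phi * ('X - 1) ^+ phi) :> {poly int}.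
  by rewrite -[K ^+ phi * _](subrK 1) HS; ring.
by rewrite {1}e HG'; ring.
Qed.

(** * Conjugation and valuations modulo [Phi] *)

Lemma dvd_cyclo_Xqm1 p s : (0 < p * s)%N ->
  exists M, cyclo p s \Po 'X^((p * s).-1) = M * cyclo p s.
Proof.
move=> ps0; set Phi := cyclo p s.
have Xq k : exists M, 'X^(p * s * k) = 1 + M * Phi.
  have := subrX1 ('X^(p * s) : {poly int}) k; rewrite -exprM -[_ - 1 in RHS]cyclo_mulXn1.
  set S := \sum_(i < _) _ => e; exists (('X^s - 1) * S).
  by rewrite -[LHS](subrK 1) e -/Phi; ring.
have [M1 HM1] := Xq 1%N; rewrite muln1 in HM1.
set sPhi := Phi \Po _.
have sE : sPhi = \sum_(i < p) 'X^((p * s).-1 * (s * i)).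
  rewrite /sPhi /Phi /cyclo rmorph_sum /=; apply: eq_bigr => i _.
  by rewrite -exprM rmorphXn /= comp_polyX -exprM.
(* Conjugation reverses the exponents [s * i] of [Phi] up to a shift, since [X^(ps)] is 1 modulo
   [Phi]. *)
have rev : exists M, 'X^(p * s) * sPhi = 'X^s * Phi + M * Phi.
  have -> : 'X^s * Phi = \sum_(i < p) 'X^(s * (p - i)).
    rewrite /Phi /cyclo mulr_sumr (reindex_inj rev_ord_inj) /=.
    apply: eq_bigr => i _; rewrite -exprM -exprD; congr 'X^_.
    by rewrite -mulnS subnSK.
  rewrite sE mulr_sumr.
  elim/big_ind2 : _ => [|x1 x2 y1 y2 [A ->] [B ->]|i _].
  - by exists 0; rewrite mul0r addr0.
  - by exists (A + B); ring.
  have [M HM] := Xq (s * i)%N; exists ('X^(s * (p - i)) * M).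
  have -> : 'X^(p * s) * 'X^((p * s).-1 * (s * i)) =
      'X^(s * (p - i)) * 'X^(p * s * (s * i)) :> {poly int}.
    rewrite -!exprD; congr 'X^_; have := ltn_ord i; nia.
  by rewrite HM; ring.
have [M HM] := rev; exists ('X^s + M - M1 * sPhi).
have e : sPhi = 'X^(p * s) * sPhi - M1 * Phi * sPhi by rewrite HM1; ring.
by rewrite {1}e HM; ring.
Qed.

(** [X - 1] is not a zero divisor modulo [cyclo p s]: evaluation at 1, where [cyclo p s] takes the
    nonzero value [p], forces [Z.[1] = 0]. *)
Lemma cyclo_cancel_Xm1 p s (H Z : {poly int}) : (0 < p)%N ->
  ('X - 1) * H = Z * cyclo p s -> exists Z', H = Z' * cyclo p s.
Proof.
move=> p0 e; have := congr1 (horner^~ 1) e.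
rewrite !hornerM horner_cyclo1 hornerD hornerX hornerN hornerC subrr mul0r => /esym/eqP.
rewrite mulf_eq0 pnatr_eq0 (gtn_eqF p0) orbF => /eqP Z1.
have [K HK] := X_sub1_root Z; rewrite Z1 add0r in HK; exists K.
have X1 : ('X - 1 : {poly int}) != 0 by rewrite polyXsubC_eq0.
by apply: (mulfI X1); rewrite e HK; ring.
Qed.

(* [X - 1] generates the only prime above [p] modulo [Phi], and that prime is
   stable under the conjugation [X |-> X^(ps - 1)], so [F] and its conjugate
   have the same [(X - 1)]-adic valuation. *)
Lemma descent p b (F : {poly int}) e : prime p ->
  dvd_mod (cyclo p (p ^ b)) (('X - 1) ^+ (e + e))
    (F * (F \Po 'X^((p * p ^ b).-1))) ->
  dvd_mod (cyclo p (p ^ b)) (('X - 1) ^+ e) F.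
Proof.
move=> pp; set Phi := cyclo _ _; set q := (p * p ^ b)%N.
have p0 := prime_gt0 pp.
have q0 : (0 < q)%N by rewrite muln_gt0 p0 expn_gt0 p0.
have [M HM] := dvd_cyclo_Xqm1 q0; rewrite -/Phi in HM.
have [U0 [V0 Hp]] := cyclo_dvd_p b pp; rewrite -/Phi in Hp.
set phi := (_ - _)%N in Hp.
have phi0 : (0 < phi)%N.
  by rewrite subn_gt0 ltn_Pmull ?prime_gt1 // expn_gt0 prime_gt0.
set sigma := fun F : {poly int} => F \Po 'X^(q.-1); rewrite -/(sigma F).
elim: e F => [|e IH] F; first by exists F, 0; rewrite expr0; ring.
move=> [W [V e1]].
(* At 1, [F] and its conjugate agree, the power of [X - 1] vanishes and [Phi] becomes [p]; hence [p]
   divides the square of [F.[1]]. *)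
have p1 : (p %| F.[1])%Z.
  have := congr1 (horner^~ 1) e1; rewrite addSn exprS.
  rewrite /sigma hornerM horner_comp hornerXn expr1n hornerD !hornerM horner_cyclo1.
  rewrite hornerD hornerX hornerN hornerC subrr mul0r mulr0 add0r => e2.
  have : (p %| F.[1] * F.[1])%Z by rewrite e2 natz dvdz_mull.
  rewrite !dvdzE abszM Euclid_dvdM // => /orP[]//.
have [K HK] := X_sub1_root F.
have [F' [V1 HF]] : dvd_mod Phi ('X - 1) F.
  have [c Hc] := dvdzP p1.
  exists (c%:P * U0 * ('X - 1) ^+ phi.-1 + K), (c%:P * V0).
  rewrite {1}HK Hc -natz polyCM rmorph_nat Hp -(prednK phi0) exprS /=.
  by ring.
have sF : sigma F = sigma F' * ('X^(q.-1) - 1) + sigma V1 * M * Phi.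
  rewrite HF /sigma comp_polyD !comp_polyM HM comp_polyD rmorphN rmorph1 /= comp_polyX.
  by ring.
(* [X] times the conjugate of [X - 1] is therefore [-(X - 1)] modulo [Phi]. Multiplying the
   hypothesis by [X] thus produces a factor [(X - 1)^2] to cancel, leaving the exponent [e + e] for
   [F']. *)
have Xq : 'X * 'X^(q.-1) = 1 + ('X^(p ^ b) - 1) * Phi :> {poly int}.
  by rewrite -exprS prednK // /q -[LHS](subrK 1) -cyclo_mulXn1 -/Phi; ring.
suff [F'' [V'' HF']] : dvd_mod Phi (('X - 1) ^+ e) F'.
  by exists F'', (V'' * ('X - 1) + V1); rewrite HF HF' exprS; ring.
apply: IH.
have [Z HZ] : exists Z, ('X - 1) * (('X - 1) *
    (F' * sigma F' + ('X - 1) ^+ (e + e) * ('X * W))) = Z * Phi.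
  exists ((F' * ('X - 1) + V1 * Phi) * sigma F' * ('X^(p ^ b) - 1)
    + V1 * sigma F' * (1 - 'X) + 'X * F * (sigma V1 * M) - 'X * V).
  have -> : ('X - 1) * (('X - 1) *
    (F' * sigma F' + ('X - 1) ^+ (e + e) * ('X * W)))
    = ('X - 1) ^+ 2 * (F' * sigma F') + 'X * (W * ('X - 1) ^+ (e.+1 + e.+1)).
    by rewrite addSn addnS !exprS; ring.
  have -> : W * ('X - 1) ^+ (e.+1 + e.+1) = F * sigma F - V * Phi by rewrite e1; ring.
  have -> : F * sigma F = F * sigma F' * ('X^(q.-1) - 1) + F * (sigma V1 * M * Phi).
    by rewrite sF; ring.
  have -> : 'X * (F * sigma F' * ('X^(q.-1) - 1) + F * (sigma V1 * M * Phi) - V * Phi)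
     = F * sigma F' * ('X * 'X^(q.-1) - 'X) + 'X * F * (sigma V1 * M * Phi) - 'X * V * Phi.
    by ring.
  rewrite Xq {1}HF; ring.
have [Z1 HZ1] := cyclo_cancel_Xm1 p0 HZ.
have [Z2 HZ2] := cyclo_cancel_Xm1 p0 HZ1.
by exists (- ('X * W)), Z2; rewrite -HZ2; ring.
Qed.

(** [p] and [(X - 1)^phi] divide each other modulo [Phi], so this is [descent] with exponent
    [phi * a]. *)
Lemma dvd_mod_p_of_norm p b a (F : {poly int}) : prime p ->
  dvd_mod (cyclo p (p ^ b)) (p%:R ^+ (a + a)) (F * (F \Po 'X^((p * p ^ b).-1))) ->
  dvd_mod (cyclo p (p ^ b)) (p%:R ^+ a) F.
Proof.
move=> pp; set Phi := cyclo _ _; move=> [U [V e]].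
have [U0 [V0 Hp]] := cyclo_dvd_p b pp; rewrite -/Phi in Hp.
have [G HG] := cyclo_modp b pp; rewrite -/Phi in HG.
set phi := (_ - _)%N in Hp HG.
have pw k (A B : {poly int}) : dvd_mod Phi A B -> dvd_mod Phi (A ^+ k) (B ^+ k).
  move=> [A1 [A2 ->]]; elim: k => [|k [B1 [B2 IH]]].
    by exists 1, 0; rewrite !expr0; ring.
  rewrite [X in dvd_mod _ _ X]exprS IH; exists (A1 * B1), ((A1 * A + A2 * Phi) * B2 + A2 * B1 * A ^+ k).
  by rewrite exprS; ring.
have tr (A B D : {poly int}) : dvd_mod Phi A B -> dvd_mod Phi B D -> dvd_mod Phi A D.
  move=> [A1 [A2 ->]] [A3 [A4 ->]]; exists (A3 * A1), (A3 * A2 + A4); ring.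
have d1 : dvd_mod Phi (('X - 1) ^+ phi) p%:R by exists U0, V0.
have d2 : dvd_mod Phi p%:R (('X - 1) ^+ phi) by exists G, 1; rewrite HG; ring.
apply: (tr _ (('X - 1) ^+ (phi * a))); first by rewrite exprM; apply: pw.
apply: descent => //; rewrite -mulnDr exprM.
apply: (tr _ (p%:R ^+ (a + a))); first exact: pw.
by exists U, V.
Qed.

(** * Circulant matrices as polynomials modulo [X^q - 1] *)

Lemma Xn_modn q a :
  exists V : {poly int}, 'X^a = 'X^(a %% q) + V * ('X^q - 1).
Proof.
exists ('X^(a %% q) * \sum_(i < a %/ q) 'X^q ^+ i).
have := subrX1 ('X^q : {poly int}) (a %/ q); set S := \sum_(i < _) _ => HS.
rewrite {1}(divn_eq a q) exprD mulnC exprM -['X^q ^+ _](subrK 1) HS.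
by ring.
Qed.

Lemma ord_diffK n (j : 'I_n) : involutive (ord_diff j).
Proof.
move=> d; apply: val_inj => /=; have hj := ltn_ord j; have hd := ltn_ord d.
have [ledj|ltjd] := leqP d j.
  rewrite (_ : j + n - d = j - d + n)%N; last by lia.
  rewrite modnDr (modn_small (m := (j - d)%N)); last by lia.
  by rewrite (_ : j + n - (j - d) = d + n)%N ?modnDr ?modn_small //; lia.
rewrite (modn_small (m := (j + n - d)%N)); last by lia.
by rewrite (_ : j + n - (j + n - d) = d)%N ?modn_small //; lia.
Qed.

Lemma ord_diff_modn n q (j k : 'I_n) : (0 < q)%N -> (q %| n)%N ->
  (ord_diff j k = j + q.-1 * k %[mod q])%N.
Proof.
move=> q0 /dvdnP [c nE]; have hk := ltn_ord k; rewrite /= modn_dvdm; last first.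
  by rewrite nE dvdn_mull.
rewrite -(modnMDl c (j + q.-1 * k)) -(modnMDl k (j + n - k)) -nE.
by congr (_ %% _)%N; nia.
Qed.

Definition row_poly n (h : 'rV[int]_n) : {poly int} := \sum_j h 0 j *: 'X^j.

(** Grouping the product by [d = j - k] modulo [n] gives the periodic autocorrelations of [h], which
    row 0 of [H *m H^T] shows to vanish for nonzero [d]. As [q] divides [n], reduction modulo [q]
    respects this grouping. *)
Lemma hadamard_circ_norm n q (h : 'rV[int]_n) :
  (0 < n)%N -> (0 < q)%N -> (q %| n)%N -> hadamard (circ h) ->
  exists V, row_poly h * (row_poly h \Po 'X^(q.-1)) = n%:R + V * ('X^q - 1).
Proof.
case: n h => // n h _ q0 qn [_ HH].
have corr (d : 'I_n.+1) : \sum_j h 0 j * h 0 (ord_diff j d) = n.+1%:R *+ (d == 0).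
  have := congr1 (fun A : 'M_n.+1 => A 0 d) HH; rewrite !mxE eq_sym => <-.
  apply: eq_bigr => j _; rewrite !mxE; congr (h 0 _ * _).
  by apply: val_inj; rewrite /= subn0 modnDr modn_small.
have [V HV] : exists V, row_poly h * (row_poly h \Po 'X^(q.-1)) =
    (\sum_j \sum_k (h 0 j * h 0 k) *: 'X^(ord_diff j k)) + V * ('X^q - 1).
  rewrite /row_poly raddf_sum mulr_suml.
  elim/big_ind2 : _ => [|x1 x2 y1 y2 [A ->] [B ->]|j _].
  - by exists 0; rewrite mul0r addr0.
  - by exists (A + B); ring.
  rewrite mulr_sumr.
  elim/big_ind2 : _ => [|x1 x2 y1 y2 [A ->] [B ->]|k _].
  - by exists 0; rewrite mul0r addr0.
  - by exists (A + B); ring.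
  have [A HA] := Xn_modn q (j + q.-1 * k).
  have [B HB] := Xn_modn q (ord_diff j k).
  exists ((h 0 j * h 0 k) *: (A - B)).
  rewrite /= comp_polyZ rmorphXn /= comp_polyX -exprM -scalerAl -scalerAr scalerA -exprD HA HB.
  rewrite (ord_diff_modn _ _ q0 qn) -scalerAl -scalerDr; congr (_ *: _); ring.
exists V; rewrite HV; congr (_ + _).
have swap j : \sum_k (h 0 j * h 0 k) *: 'X^(ord_diff j k) =
    \sum_(d < n.+1) (h 0 j * h 0 (ord_diff j d)) *: 'X^d :> {poly int}.
  rewrite (reindex_inj (can_inj (ord_diffK j))).
  by apply: eq_bigr => d _; rewrite ord_diffK.
rewrite (eq_bigr _ (fun j _ => swap j)).
rewrite exchange_big (bigD1 0) //= -scaler_suml corr eqxx expr0 scaler_nat.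
rewrite big1 ?addr0 // => d d0; rewrite -scaler_suml corr (negPf d0) scale0r.
by [].
Qed.

(** * Coefficient bounds after reduction modulo [X^q - 1] *)

Lemma rmodp_Xn_sub1 q a : (0 < q)%N ->
  rmodp 'X^a ('X^q - 1 : {poly int}) = 'X^(a %% q).
Proof.
move=> q0; have [V ->] := Xn_modn q a; rewrite addrC rmodp_addl_mul_small //.
  exact: monic_Xn_sub1.
by rewrite size_polyXn size_Xn_sub1 // ltnS ltn_pmod.
Qed.

Lemma card_modn_le n q M s i : n = (q * M)%N -> (0 < q)%N ->
  (#|[pred j : 'I_n | i == (j + s) %% q]| <= M)%N.
Proof.
move=> nE q0.
have lt (j : 'I_n) : (j %/ q < M)%N by rewrite ltn_divLR // mulnC -nE.
(* Within a fixed residue class modulo [q], the quotient [j %/ q] determines [j]. *)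
rewrite -(card_ord M) -(card_in_imset (f := fun j => Ordinal (lt j))).
  exact: max_card.
move=> j k; rewrite !inE => /eqP ej /eqP ek [ejk].
have : j = k %[mod q] by apply/eqP; rewrite -(eqn_modDr s) -ej -ek.
by move=> e; apply: val_inj; rewrite /= (divn_eq j q) (divn_eq k q) ejk e.
Qed.

Lemma coef_fold_le n q M s i (h : 'rV[int]_n) : n = (q * M)%N -> (0 < q)%N ->
  (forall j, `|h 0 j| <= 1) ->
  `|(rmodp (row_poly h * 'X^s) ('X^q - 1))`_i| <= M%:R.
Proof.
move=> nE q0 h1; have mq := monic_Xn_sub1 int q0.
rewrite /row_poly mulr_suml rmodp_sum // coef_sum.
apply: le_trans (ler_norm_sum _ _ _) _.
apply: (@le_trans _ _ (\sum_(j < n) (i == (j + s) %% q)%N%:R)).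
  apply: ler_sum => j _; rewrite -scalerAl -exprD rmodpZ // rmodp_Xn_sub1 //.
  rewrite coefZ coefXn normrM [X in _ * X]ger0_norm ?ler0n //.
  by rewrite ler_piMl ?ler0n.
rewrite -natr_sum ler_nat -big_mkcond /= sum1_card.
exact: card_modn_le.
Qed.

(** Each reduced coefficient is a multiple of [d], yet a difference of two terms bounded by [M],
    hence zero. *)
Lemma fold_small_dvd n q M s d (h : 'rV[int]_n) (U V : {poly int}) :
  n = (q * M)%N -> (0 < q)%N -> (2 * M < d)%N -> (forall j, `|h 0 j| <= 1) ->
  row_poly h * ('X^s - 1) = d%:R * U + V * ('X^q - 1) ->
  exists W, row_poly h * ('X^s - 1) = W * ('X^q - 1).
Proof.
move=> nE q0 Md h1 e; have mq := monic_Xn_sub1 int q0.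
set R := row_poly h in e *.
suff T0 : rmodp (R * ('X^s - 1)) ('X^q - 1) = 0.
  exists (rdivp (R * ('X^s - 1)) ('X^q - 1)).
  by rewrite {1}(rdivp_eq mq (R * ('X^s - 1))) T0 addr0.
have e1 : rmodp (R * ('X^s - 1)) ('X^q - 1) = d%:R *: rmodp U ('X^q - 1).
  rewrite e rmodpD // rmodp_mull // addr0 -rmodpZ //.
  by rewrite -(rmorph_nat polyC) mul_polyC.
apply/polyP => i; rewrite coef0.
have := congr1 (fun P : {poly int} => `|P`_i|) e1.
have -> : R * ('X^s - 1) = R * 'X^s - R * 'X^0 by rewrite expr0; ring.
rewrite rmodpB // coefB coefZ normrM => e2.
have := ler_normB (rmodp (R * 'X^s) ('X^q - 1))`_i (rmodp (R * 'X^0) ('X^q - 1))`_i.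
have b1 := coef_fold_le s i nE q0 h1.
have b2 := coef_fold_le 0 i nE q0 h1.
rewrite -/R in b1 b2; rewrite e2 => b3.
have b4 := le_trans b3 (lerD b1 b2).
have [z|nz] := eqVneq (rmodp U ('X^q - 1))`_i 0.
  by apply/eqP; rewrite -normr_eq0 e2 z normr0 mulr0.
exfalso; move: b4; apply/negP; rewrite -ltNge.
apply: (@lt_le_trans _ _ d%:R).
  by rewrite -natrD ltr_nat addnn -mul2n.
by rewrite normr_nat ler_peMr ?ler0n // -gtz0_ge1 normr_gt0.
Qed.

(** * Nonexistence when [p ^ a] dominates [m] *)

Lemma no_circulant_hadamard p a m : prime p -> (0 < m)%N ->
  (8 * m ^ 2 < p ^ a)%N ->
  ~ exists H : 'M[int]_(4 * (p ^ a * m) ^ 2)%N, hadamard H /\ circulant H.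
Proof.
move=> pp m0 lt8 [H [hH [h HE]]]; rewrite {H}HE in hH.
set n := (4 * _)%N in h hH.
have a0 : (0 < a)%N.
  by case: a lt8 @n h hH => // lt8; exfalso; move: lt8; rewrite expn0; nia.
have p0 := prime_gt0 pp.
(* This makes [q = p^(2a)], so that [n = q * M] with [M = 4 * m ^ 2], and [2 * M < p ^ a] is the
   hypothesis. *)
pose b := (a + a).-1; set s := (p ^ b)%N; set q := (p * p ^ b)%N.
have qE : q = (p ^ (a + a))%N by rewrite /q -expnS prednK ?addn_gt0 ?a0.
have s0 : (0 < s)%N by rewrite expn_gt0 p0.
have q0 : (0 < q)%N by rewrite muln_gt0 p0.
have nE : n = (q * (4 * m ^ 2))%N by rewrite /n qE expnD expnMn; ring.
have n0 : (0 < n)%N by rewrite /n muln_gt0 expn_gt0 muln_gt0 expn_gt0 p0 m0.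
have qn : (q %| n)%N by rewrite nE dvdn_mulr.
set R := row_poly h; set Phi := cyclo p s.
have [V HV] := hadamard_circ_norm n0 q0 qn hH; rewrite -/R in HV.
have qPhi : 'X^q - 1 = Phi * ('X^s - 1) by rewrite cyclo_mulXn1.
have [U [V1 HR]] : dvd_mod Phi (p%:R ^+ a) R.
  apply: dvd_mod_p_of_norm => //.
  exists (4 * m ^ 2)%:R, (V * ('X^s - 1)); rewrite -/q HV qPhi -natrX nE qE.
  by rewrite (natrM _ (p ^ (a + a))) -[cyclo _ _]/Phi; ring.
have h1 j : `|h 0 j| <= 1.
  have := hH.1 (Ordinal n0) j; rewrite !mxE.
  have -> : ord_diff j (Ordinal n0) = j.
    by apply: val_inj; rewrite /= subn0 modnDr modn_small.
  by case=> ->; rewrite ?normrN normr1.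
have [W HW] : exists W, R * ('X^s - 1) = W * ('X^q - 1).
  apply: (fold_small_dvd (d := p ^ a) (U := U * ('X^s - 1)) (V := V1) nE q0) => //.
    by rewrite mulnA.
  by rewrite -/R qPhi natrX HR; ring.
have RE : R = W * Phi.
  apply: (mulIf (x := 'X^s - 1)); last by rewrite HW qPhi mulrA.
  by rewrite -size_poly_eq0 size_Xn_sub1.
(* [n] is the norm of [R] minus a multiple of [X^q - 1], and [Phi] divides both. *)
apply: (@cyclo_ndvd_nat p s n (W * (R \Po 'X^(q.-1)) - V * ('X^s - 1))) => //.
  exact: prime_gt1.
rewrite -/Phi -[LHS](addrK (V * ('X^q - 1))) -HV qPhi {1}RE; ring.
Qed.

(** * Prescribing the number of prime divisors *)

Lemma omega_pXM p a m : prime p -> (0 < a)%N -> (0 < m)%N -> ~~ (p %| m)%N ->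
  omega (p ^ a * m) = (omega m).+1.
Proof.
move=> pp a0 m0 pm; have p0 := prime_gt0 pp.
rewrite /omega; apply: (perm_size (s2 := p :: primes m)); apply: uniq_perm.
- exact: primes_uniq.
- by rewrite /= primes_uniq mem_primes (negPf pm) !andbF.
move=> r; rewrite primesM ?expn_gt0 ?p0 // primesX // primes_prime //.
by rewrite !inE.
Qed.

Lemma exists_odd_omega k :
  exists m, [/\ odd m, ~~ (3 %| m)%N & omega m = k].
Proof.
elim: k => [|k [m [mo m3 mk]]]; first by exists 1%N.
(* A prime above [m + 3] differs from 2 and 3 and cannot divide [m]. *)
have [p lt_p pp] := prime_above (m + 3).
have m0 : (0 < m)%N by case: m mo {m3 mk lt_p}.
have pm : ~~ (p %| m)%N.
  by apply/negP => /(dvdn_leq m0); lia.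
exists (p ^ 1 * m)%N; rewrite omega_pXM // mk expn1; split=> //.
  by rewrite oddM mo andbT; case: (even_prime pp) => // p2; lia.
rewrite Euclid_dvdM // negb_or m3 andbT dvdn_prime2 //.
by apply/negP => /eqP; lia.
Qed.
End NoCirculantHadamard.

Theorem theorem1p2 (k : nat) (hk : (1 < k)%N) :
  infinite_set [set h : nat |
    [/\ odd h,
        omega h = k
      & ~ exists H : 'M[int]_(4 * h ^ 2)%N, hadamard H /\ circulant H]].
Proof.
have [m [mo m3 mk]] := exists_odd_omega k.-1.
have m0 : (0 < m)%N by case: m mo {m3 mk}.
(* The exponent exceeds [8 * m ^ 2], hence so does the power of 3. *)
pose f a := (3 ^ (8 * m ^ 2 + a).+1 * m)%N.
have f_inj : {in [set: nat] &, injective f}.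
  move=> a b _ _ /eqP; rewrite eqn_pmul2r // => /eqP /(expnI (isT : 1 < 3)%N).
  by lia.
have := inj_card_eq f_inj; rewrite card_eq_le => /andP[_ le_f].
apply/infiniteP; apply: card_le_trans le_f _.
apply: subset_card_le => _ [a _ <-]; split.
- by rewrite /f oddM oddX mo orbT.
- by rewrite /f omega_pXM // mk prednK // ltnW.
apply: no_circulant_hadamard => //.
apply: leq_ltn_trans (ltn_expl _ (isT : 1 < 3)%N); lia.
Qed.
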